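(* Let $\Omega\subset\mathbb{R}^N$ be a compact set and let $f:\Omega\to\Omega$ be a diffeomorphism (the decision function). Let $(T_n)_{n\ge1}$ be a stationary sequence of diffeomorphisms $T_n:\Omega\to\Omega$ (with respect to the distortion pseudo-metric $D$ defined in the context). Put $f_n(x)=f(T_nT_{n-1}\cdots T_1x)$ for $x\in\Omega$. Then the distortion of the functions $f_n$ has a well-defined exponential growth rate: there is a number $\lambda$ such that almost surely $$\lim_{n\to\infty}\ \sup_{x,y\in\Omega}\left|J_{f_n}(x)J_{f_n}(y)^{-1}\right|^{1/n}=e^{\lambda}.$$
   Context: For a diffeomorphism $g:\Omega\to\Omega$, $J_g=\{\partial g_i/\partial x_j\}$ is the Jacobian matrix and $|J_g|$ denotes the (absolute value of the) Jacobian determinant, so $|J_{g}(x)J_{g}(y)^{-1}|=|\det J_g(x)|/|\det J_g(y)|$. Jacobian determinants of diffeomorphisms are bounded and bounded away from $0$ on $\Omega$. The distortion pseudo-metric on diffeomorphisms of $\Omega$ is $$D(g,h)=\sup_{x,y\in\Omega}\left|\log\frac{|J_g(x)|}{|J_h(x)|}\frac{|J_h(y)|}{|J_g(y)|}\right|.$$ A layer map $T$ acts on functions by $(T^*g)(x)=g(Tx)$, so that $f_n=T_1^*T_2^*\cdots T_n^*f$, and $D(T^*g,T^*h)=D(g,h)$ for diffeomorphisms $T$. Stationary sequence (integrable ergodic cocycle): there are a probability space $(M,\mu)$, a measurable, measure-preserving, ergodic transformation $L:M\to M$, and a measurable assignment $m\mapsto T_m$ of a layer map to each $m\in M$, such that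 all distances involved are measurable functions of $m$ and $\int_M D(T_m^*g,g)\,d\mu(m)<\infty$ for $g$ a diffeomorphism of $\Omega$ (this does not depend on $g$). The sequence is $T_i=T_{L^{i-1}m}$, $i\ge1$, and ''almost surely'' means for $\mu$-almost every $m$. Products of maps denote composition. *)

(* Defs.v *)
From HB Require Import structures.
From mathcomp Require Import all_boot all_order all_algebra.
From mathcomp Require Import all_classical all_reals all_analysis.
Set Implicit Arguments.
Unset Strict Implicit.
Unset Printing Implicit Defensive.
Import Order.TTheory GRing.Theory Num.Theory.
Import numFieldNormedType.Exports.
Local Open Scope classical_set_scope.
Local Open Scope ring_scope.

(* The library's [jacobian] acts on row vectors: its (j, i) entry is
   d g_i / d x_j, whence the transposition. *)
Definition Jmx (R : realType) (N : nat) (g : 'rV[R]_N -> 'rV[R]_N)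
  (x : 'rV[R]_N) : 'M[R]_N := (jacobian g x)^T.

Definition C1_on (R : realType) (N : nat) (U : set 'rV[R]_N)
    (g : 'rV[R]_N -> 'rV[R]_N) : Prop :=
  (forall x, U x -> differentiable g x) /\
  (forall x, U x -> {for x, continuous (Jmx g)}).

(* C^1 diffeomorphism between the open sets U and V. *)
Definition open_diffeo (R : realType) (N : nat) (U V : set 'rV[R]_N)
    (g : 'rV[R]_N -> 'rV[R]_N) : Prop :=
  [/\ open U, open V, C1_on U g &
   exists h : 'rV[R]_N -> 'rV[R]_N,
    [/\ C1_on V h, set_fun U V g, set_fun V U h,
      {in U, cancel g h} & {in V, cancel h g}]].

(* A compact set may be too thin for a map on it to determine its derivatives,
   so a diffeomorphism of Omega is given with an extension to a neighbourhood:
   it is the restriction of a diffeomorphism between open neighbourhoods of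
   Omega which maps Omega onto itself.  The values of g away from Omega are
   irrelevant: only the germ of g along Omega is ever used. *)
Definition is_diffeo (R : realType) (N : nat) (Omega : set 'rV[R]_N)
    (g : 'rV[R]_N -> 'rV[R]_N) : Prop :=
  g @` Omega = Omega /\
  exists U V : set 'rV[R]_N, Omega `<=` U /\ open_diffeo U V g.

Definition absJ (R : realType) (N : nat) (g : 'rV[R]_N -> 'rV[R]_N)
  (x : 'rV[R]_N) : R := `|\det (Jmx g x)|.

(* The supremum is that of a bounded set when g and h are diffeomorphisms of a
   compact set Omega. *)
Definition distortion (R : realType) (N : nat) (Omega : set 'rV[R]_N)
    (g h : 'rV[R]_N -> 'rV[R]_N) : R :=
  sup [set `|ln ((absJ g x / absJ h x) * (absJ h y / absJ g y))|
       | x in Omega & y in Omega].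

Definition measure_preserving (R : realType) (d : measure_display)
    (M : measurableType d) (mu : probability M R) (L : M -> M) : Prop :=
  measurable_fun setT L /\
  forall A, measurable A -> mu (L @^-1` A) = mu A.

Definition ergodic (R : realType) (d : measure_display)
    (M : measurableType d) (mu : probability M R) (L : M -> M) : Prop :=
  measure_preserving mu L /\
  forall A, measurable A -> L @^-1` A = A -> mu A = 0%E \/ mu A = 1%E.

(* layers L T m n = T_n o ... o T_1, where T_i = T (L^(i-1) m). *)
Fixpoint layers (M V : Type) (L : M -> M) (T : M -> V -> V) (m : M)
    (n : nat) : V -> V :=
  if n is k.+1 then T (iter k L m) \o layers L T m k else id.

(* Integrable ergodic cocycle of diffeomorphisms.  A layer map S acts on
   functions by S* g = g o S, so T_1* T_2* ... T_n* g = g o layers L T m n.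
   Layer maps carry the coarsest sigma-algebra making S |-> D(S* g, h)
   measurable for all diffeomorphisms g and h; measurability of m |-> T m is
   then the case n = 1 of [cocycle_measurable].  Since layer maps are
   D-isometries and L is measurable, this field also covers the distances
   D(T_1* ... T_n* g, T_1* ... T_k* h).
   In [cocycle_integrable] the choice of g is immaterial, by the triangle
   inequality and the same isometry property. *)
Record stationary_diffeos (R : realType) (N : nat) (Omega : set 'rV[R]_N)
    (d : measure_display) (M : measurableType d) (mu : probability M R)
    (L : M -> M) (T : M -> 'rV[R]_N -> 'rV[R]_N) : Prop :=
  StationaryDiffeos {
    cocycle_ergodic : ergodic mu L ;
    cocycle_diffeo : forall m, is_diffeo Omega (T m) ;
    cocycle_measurable : forall (g h : 'rV[R]_N -> 'rV[R]_N) (n : nat),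
      is_diffeo Omega g -> is_diffeo Omega h ->
      measurable_fun setT
        (fun m => distortion Omega (g \o layers L T m n) h) ;
    cocycle_integrable : exists2 g : 'rV[R]_N -> 'rV[R]_N,
      is_diffeo Omega g &
      (\int[mu]_m (distortion Omega (g \o T m) g)%:E < +oo)%E
  }.

(* Main.v *)
(* Let a_n(m) = D(T_n ... T_1, id).  Since D is invariant under composition on the
   right by a diffeomorphism of Omega, a is a nonnegative integrable subadditive
   cocycle over L, and n times the logarithm of the supremum in the theorem, which
   is D(f T_n ... T_1, id), differs from a_n by a bounded amount.  It remains to
   prove Kingman's theorem for a, with limit lambda = inf_n (1/n) int a_n.

   Everything rests on one maximal-type statement (eventually_gt0): if b is an
   integrable subadditive cocycle with int b_n >= n delta, delta > 0, then almost
   surely b_n > 0 eventually.  Otherwise, by ergodicity, almost every orbit could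
   be cut into stretches along which b is at most (delta / 2) times their length,
   up to a part of small integral, contradicting the lower bound on int b_n.
   Applied to a_n - n c this gives liminf a_n / n >= lambda; applied to n c minus
   a Birkhoff sum it gives the upper half of Birkhoff's theorem, which yields
   limsup a_n / n <= lambda by averaging a over windows of length k. *)

From HB Require Import structures.
Require Import Defs.
From mathcomp Require Import all_boot all_order all_algebra.
From mathcomp Require Import all_classical all_reals all_analysis.
From mathcomp Require Import measurable_realfun.
From mathcomp Require Import perm lra zify.
Import Order.TTheory GRing.Theory Num.Theory.
Import numFieldNormedType.Exports.
Local Open Scope classical_set_scope.
Local Open Scope ring_scope.

Set Implicit Arguments.
Unset Strict Implicit.
Unset Printing Implicit Defensive.

(** * Birkhoff sums and subadditive cocycles along a single orbit *)

Section birkhoff_sums.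
Context {X : Type} {R : realType} (L : X -> X).
Implicit Types (f g : X -> R) (b : nat -> X -> R) (x : X) (n k q : nat).

Definition birkhoff f n x : R := \sum_(i < n) f (iter i L x).

Lemma birkhoff0 f x : birkhoff f 0 x = 0.
Proof. by rewrite /birkhoff big_ord0. Qed.

Lemma birkhoff1 f x : birkhoff f 1 x = f x.
Proof. by rewrite /birkhoff big_ord1. Qed.

Lemma birkhoffD f n k x :
  birkhoff f (n + k) x = birkhoff f n x + birkhoff f k (iter n L x).
Proof.
rewrite /birkhoff big_split_ord /=; congr (_ + _).
by apply: eq_bigr => i _; rewrite addnC iterD.
Qed.

Lemma birkhoff_ge0 f n x : (forall y, 0 <= f y) -> 0 <= birkhoff f n x.
Proof. by move=> f0; apply: sumr_ge0. Qed.

Lemma ler_birkhoff f g n x : (forall y, f y <= g y) ->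
  birkhoff f n x <= birkhoff g n x.
Proof. by move=> fg; apply: ler_sum. Qed.

Definition subadditive b :=
  (forall x, b 0%N x = 0) /\
  (forall n k x, b (n + k)%N x <= b n x + b k (iter n L x)).

Lemma subadditive_le_birkhoff b n x : subadditive b ->
  b n x <= birkhoff (b 1%N) n x.
Proof.
move=> [b0 bD]; elim: n => [|n ih]; first by rewrite b0 birkhoff0.
by rewrite -addn1 (le_trans (bD _ _ _))// birkhoffD birkhoff1 lerD2r.
Qed.

(* From a point outside B one jumps ahead to a time k <= K with b k <= 0, from
   a point of B one moves by one step; the last jump ends in the final window
   of length K. *)
Lemma subadditive_cover b (B : set X) K :
  subadditive b ->
  (forall x, ~ B x -> exists2 k, (0 < k <= K)%N & b k x <= 0) ->
  let p := fun x => Num.max (b 1%N x) 0 in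
  forall q x, b (q + K)%N x <=
    birkhoff (p \_ B) q x + birkhoff p K (iter q L x).
Proof.
move=> subb hB p.
have p0 y : 0 <= p y by rewrite /p le_max lexx orbT.
have pB0 y : 0 <= (p \_ B) y by rewrite patchE; case: ifP.
have bp n x : b n x <= birkhoff p n x.
  rewrite (le_trans (subadditive_le_birkhoff n x subb))//.
  by apply: ler_birkhoff => y; rewrite /p le_max lexx.
have [b0 bD] := subb.
elim/ltn_ind => -[_ x|q ih x].
  by rewrite birkhoff0 add0r add0n; exact: bp.
have [Bx|nBx] := pselect (B x).
  rewrite addSn -add1n (le_trans (bD _ _ _))// -(add1n q) birkhoffD -addrA.
  rewrite birkhoff1 lerD//; first by rewrite patchE mem_set// /p le_max lexx.
  by rewrite add1n (iterSr q); exact: ih.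
have [k /andP[k0 kK] bk] := hB _ nBx.
have [kq|qk] := leqP k q.+1.
  have -> : (q.+1 + K = k + (q.+1 - k + K))%N by lia.
  rewrite (le_trans (bD _ _ _))//.
  have -> : birkhoff (p \_ B) q.+1 x =
      birkhoff (p \_ B) k x + birkhoff (p \_ B) (q.+1 - k) (iter k L x).
    by rewrite -birkhoffD subnKC.
  rewrite -addrA lerD//; first by rewrite (le_trans bk)// birkhoff_ge0.
  have -> : iter q.+1 L x = iter (q.+1 - k) L (iter k L x).
    by rewrite -iterD subnK.
  by apply: ih; lia.
(* The jump passes [q.+1] but, as [k <= K], it ends within the final window; the rest of that window
   bounds the remaining steps. *)
have -> : (q.+1 + K = k + (K - (k - q.+1)))%N by lia.
rewrite (le_trans (bD _ _ _))//.
have -> : birkhoff p K (iter q.+1 L x) =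
    birkhoff p (k - q.+1) (iter q.+1 L x) +
    birkhoff p (K - (k - q.+1)) (iter k L x).
  rewrite (_ : iter k L x = iter (k - q.+1) L (iter q.+1 L x)); last first.
    by rewrite -iterD subnK// ltnW.
  by rewrite -birkhoffD subnKC//; lia.
rewrite addrA lerD//.
by rewrite (le_trans bk)// addr_ge0// birkhoff_ge0.
Qed.

End birkhoff_sums.

(** * Integrals and sets under a measure-preserving map *)

Section invariant_integrals.
Context {R : realType} {d : measure_display} {M : measurableType d}.
Context (mu : probability M R) (L : M -> M).
Hypothesis L_pres : measure_preserving mu L.
Implicit Types (f g w : M -> R) (n k : nat).

Local Notation integrable f := (mu.-integrable setT (EFin \o f)).

Lemma measurable_iter n : measurable_fun setT (iter n L).
Proof.
elim: n => [|n ih]; first exact: measurable_id.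
by apply: (measurableT_comp (proj1 L_pres)); exact: ih.
Qed.

Lemma measure_preserving_iter n A :
  measurable A -> mu (iter n L @^-1` A) = mu A.
Proof.
elim: n A => [//|n ih] A mA.
have mLA : measurable (L @^-1` A).
  by rewrite -[X in measurable X]setTI; exact: (proj1 L_pres).
rewrite (_ : iter n.+1 L @^-1` A = iter n L @^-1` (L @^-1` A))// ih//.
exact: (proj2 L_pres).
Qed.

(** The bundled form lets [mu] be pushed forward along the iterate; the image measure is [mu] again,
    so the change of variables formula becomes invariance of integrals. *)
Definition iter_mfun n : {mfun M >-> M} :=
  HB.pack (iter n L) (isMeasurableFun.Build _ _ _ _ _ (measurable_iter n)).

Lemma ge0_integral_iter n (f : M -> \bar R) :
  measurable_fun setT f -> (forall x, (0 <= f x)%E) ->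
  (\int[mu]_x f (iter n L x) = \int[mu]_x f x)%E.
Proof.
move=> mf f0.
rewrite -[LHS]/(\int[mu]_x (f \o iter_mfun n) x)%E -ge0_integral_distribution//.
by apply: eq_measure_integral => A mA _; exact: measure_preserving_iter.
Qed.

Lemma integrable_iter n f : integrable f -> integrable (f \o iter n L).
Proof.
move=> /integrableP[mf foo]; apply/integrableP; split.
  by apply: (measurableT_comp mf); exact: measurable_iter.
rewrite (@ge0_integral_iter n (fun x => `|(f x)%:E|%E))//.
exact: measurableT_comp.
Qed.

Lemma Rintegral_iter n f :
  integrable f -> \int[mu]_x f (iter n L x) = \int[mu]_x f x.
Proof.
move=> intf; rewrite /Rintegral; congr fine.
rewrite -[LHS]/(\int[mu]_x ((EFin \o f) \o iter_mfun n) x)%E.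
rewrite -integral_distribution//; last 2 first.
- exact: (measurable_int mu).
- exact: integrable_iter.
by apply: eq_measure_integral => A mA _; exact: measure_preserving_iter.
Qed.

Lemma integrable_birkhoff n f : integrable f -> integrable (birkhoff L f n).
Proof.
move=> intf; elim: n => [|n ih].
  apply: (eq_integrable measurableT (cst 0%E)); last exact: integrable0.
  by move=> x _ /=; rewrite birkhoff0.
apply: (eq_integrable measurableT
  ((EFin \o birkhoff L f n) \+ (EFin \o (f \o iter n L)))%E).
  by move=> x _ /=; rewrite -addn1 birkhoffD birkhoff1.
by apply: integrableD => //; exact: integrable_iter.
Qed.

Lemma Rintegral_birkhoff n f : integrable f ->
  \int[mu]_x birkhoff L f n x = n%:R * \int[mu]_x f x.
Proof.
move=> intf; elim: n => [|n ih].
  rewrite mul0r (@eq_Rintegral _ _ _ _ _ (cst 0)) ?Rintegral_cst ?mul0r//.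
  by move=> x _; rewrite birkhoff0.
rewrite (@eq_Rintegral _ _ _ _ _ (fun x => birkhoff L f n x + f (iter n L x))).
  rewrite RintegralD// ?ih ?Rintegral_iter//.
  - by rewrite -addn1 natrD mulrDl mul1r.
  - exact: integrable_birkhoff.
  - exact: integrable_iter.
by move=> x _; rewrite -addn1 birkhoffD birkhoff1.
Qed.

(** The preimages of G under the iterates decrease and all have the measure of G. By continuity from
    above their intersection has it too, and this intersection is strictly invariant, so ergodicity
    applies to it. *)
Lemma zero_one_subinvariant (G : set M) : ergodic mu L ->
  measurable G -> L @^-1` G `<=` G -> mu G = 0%E \/ mu G = 1%E.
Proof.
move=> [_ erg] mG LG.
pose F n := iter n L @^-1` G.
have mF n : measurable (F n).
  by rewrite -[F n]setTI; exact: measurable_iter.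
have FS n : F n.+1 `<=` F n by move=> x; rewrite /F /= => /LG.
have niF : nonincreasing_seq F.
  by apply/nonincreasing_seqP => n; apply/subsetPset; exact: FS.
have mH : measurable (\bigcap_n F n) by exact: bigcapT_measurable.
have muH : mu (\bigcap_n F n) = mu G.
  have : (mu \o F) n @[n --> \oo] --> mu (\bigcap_n F n).
    by apply: nonincreasing_cvg_mu => //; rewrite -ge0_fin_numE// fin_num_measure.
  have -> : mu \o F = cst (mu G).
    by apply/funext => n; rewrite /= measure_preserving_iter.
  by move/cvg_lim => <-//; rewrite lim_cst.
rewrite -muH; apply: erg => //.
apply/seteqP; split => x /= Hx n _; last first.
  by rewrite /F /= -[L x]/(iter 1 L x) -iterD addn1; exact: (Hx n.+1).
have := Hx n Logic.I; rewrite /F /= -[L x]/(iter 1 L x) -iterD addn1.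
exact: FS.
Qed.

End invariant_integrals.

(** * Eventual positivity of subadditive cocycles with positive mean growth *)

Section subadditive_ergodic.
Context {R : realType} {d : measure_display} {M : measurableType d}.
Context (mu : probability M R) (L : M -> M).
Hypothesis L_ergodic : ergodic mu L.
Implicit Types (f g w : M -> R) (n k : nat) (a b : nat -> M -> R).

Local Notation integrable f := (mu.-integrable setT (EFin \o f)).

Let L_pres : measure_preserving mu L. Proof. by case: L_ergodic. Qed.

Lemma integrable_measurable f : integrable f -> measurable_fun setT f.
Proof. by move=> /(measurable_int mu) /measurable_EFinP. Qed.

Lemma integrable_addr f g :
  integrable f -> integrable g -> integrable (fun x => f x + g x).
Proof. exact: integrableD. Qed.

Lemma integrable_mulrl (c : R) f :
  integrable f -> integrable (fun x => c * f x).
Proof. exact: integrableZl. Qed.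

Lemma integrable_cst_prob (c : R) : integrable (cst c).
Proof. exact: finite_measure_integrable_cst. Qed.

Lemma Rintegral_prob_cst (c : R) : \int[mu]_x (cst c x) = c.
Proof.
rewrite (Rintegral_cst _ measurableT c) -[RHS]mulr1; congr (_ * _).
by rewrite -[RHS]/(fine 1%E); congr fine; exact: probability_setT.
Qed.

Lemma subadditiveB b (c : R) :
  subadditive L b -> subadditive L (fun n x => b n x - n%:R * c).
Proof.
move=> [b0 bD]; split => [x|n k x]; first by rewrite b0 mul0r subr0.
by rewrite natrD mulrDl opprD addrACA lerD2r bD.
Qed.

Lemma measurable_le_cst f (c : R) :
  measurable_fun setT f -> measurable [set x | f x <= c].
Proof.
move=> mf; have := mf measurableT `]-oo, c]%classic (measurable_itv _).
by rewrite setTI; congr measurable.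
Qed.

Lemma integrable_max0 f : integrable f -> integrable (fun x => Num.max (f x) 0).
Proof.
move=> intf; apply: (le_integrable measurableT _ _ intf).
  apply/measurable_EFinP; apply: measurable_maxr => //.
  exact: integrable_measurable.
move=> x _ /=; rewrite lee_fin maxEle.
by case: ifP => // _; rewrite normr0.
Qed.

Lemma integrable_patch f (B : set M) :
  measurable B -> integrable f -> integrable (f \_ B).
Proof.
move=> mB intf; apply: (le_integrable measurableT _ _ intf).
  apply/measurable_EFinP; apply/(measurable_restrictT _ _).1 => //.
  by apply: measurable_funTS; exact: integrable_measurable.
move=> x _ /=; rewrite lee_fin patchE.
by case: ifP => // _; rewrite normr0.
Qed.

(** Dominated convergence with majorant [|f|]: almost every point leaves the sets [B n] for good,
    and there the restricted functions are eventually 0. *)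
Lemma Rintegral_patch_cvg0 f (B : nat -> set M) :
  integrable f -> (forall n, measurable (B n)) ->
  {ae mu, forall x, \forall n \near \oo, ~ B n x} ->
  \int[mu]_x (f \_ (B n)) x @[n --> \oo] --> (0 : R).
Proof.
move=> intf mB B0.
have mf := integrable_measurable intf.
have := @dominated_convergence _ M R mu setT measurableT
  (fun n => EFin \o (f \_ (B n))) (cst 0%E) (EFin \o (fun x => `|f x|)).
case.
- by move=> n; exact: (measurable_int mu (integrable_patch (mB n) intf)).
- exact: measurable_cst.
- apply: filterS B0 => x Bx _; apply: cvg_near_cst.
  by apply: filterS Bx => n nB /=; rewrite patchE memNset.
- exact: integrable_norm.
- apply: aeW => x n _ /=; rewrite lee_fin patchE.
  by case: ifP => // _; rewrite normr0.
- by move=> _ _; rewrite integral0 => /fine_cvg.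
Qed.

Lemma eventually_gt0 b (delta : R) :
  subadditive L b -> (forall n, integrable (b n)) -> 0 < delta ->
  (forall n, n%:R * delta <= \int[mu]_x b n x) ->
  {ae mu, forall x, \forall n \near \oo, 0 < b n x}.
Proof.
move=> subb intb delta0 ledelta.
(* The bad set: [b n x] is at most some C for infinitely many n. Allowing any C, and not only 0,
   makes the set subinvariant: one more step adds [b 1 x], which a larger constant absorbs. *)
pose G := \bigcup_C \bigcap_N \bigcup_(n in [set n | (N <= n)%N])
  [set x | b n x <= C%:R].
have mG : measurable G.
  apply: bigcupT_measurable => C; apply: bigcapT_measurable => N.
  apply: bigcup_measurable => n _; apply: measurable_le_cst.
  exact: integrable_measurable.
have LG : L @^-1` G `<=` G.
  move=> x [C _ LC]; have [C' CC'] : exists C' : nat, b 1%N x + C%:R <= C'%:R.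
    exists (Num.truncn `|b 1%N x + C%:R|).+1.
    by rewrite (le_trans (ler_norm _))// ltW// truncnS_gt.
  exists C' => // N _; have [n Nn bC] := LC N Logic.I.
  exists n.+1; first by rewrite /= ltnW.
  by rewrite /= -add1n (le_trans (proj2 subb _ _ _))// (le_trans _ CC')// lerD2l.
have [G0|G1] := zero_one_subinvariant L_pres L_ergodic mG LG.
  (* A point where positivity fails infinitely often lies in G with C = 0. *)
  exists G; split => // x /= bx; exists 0%N => // N _.
  apply: contrapT => Nx; apply: bx; exists N => // n /= Nn.
  by rewrite ltNge; apply/negP => bn; apply: Nx; exists n.
exfalso.
(* Half of delta is spent as a drift, which makes [b'] nonpositive at late times where b is bounded;
   the other half keeps the integral of [b' n] at least [n * c]. *)
pose c := delta / 2; pose b' n x := b n x - n%:R * c.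
have c0 : 0 < c by rewrite divr_gt0.
have subb' : subadditive L b' by exact: subadditiveB.
have intb' n : integrable (b' n).
  exact: integrable_addr (intb n) (integrable_cst_prob (- (n%:R * c))).
have int_b' n : n%:R * c <= \int[mu]_x b' n x.
  rewrite RintegralB//; last exact: (integrable_cst_prob (n%:R * c)).
  rewrite (Rintegral_prob_cst (n%:R * c)) lerBrDl.
  by rewrite (le_trans _ (ledelta n))// -mulrDr /c -splitr.
(* The points from which no jump of length at most K is available in the covering argument. *)
pose B K := \bigcap_(k in [set k | (0 < k <= K)%N]) ~` [set x | b' k x <= 0].
have mB K : measurable (B K).
  apply: bigcap_measurableType => k _; apply: measurableC; apply: measurable_le_cst.
  exact: integrable_measurable.
have BG : {ae mu, forall x, \forall K \near \oo, ~ B K x}.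
  exists (~` G); split; first exact: measurableC.
    by rewrite -[LHS]/(mu (~` G)) probability_setC// G1 subee.
  move=> x; apply: contra_not => -[C _ GC].
  (* Past [C / c] the drift [n * c] exceeds C, so [b' n x <= 0]; the successor also makes n
     positive. *)
  have [n Nn bn] := GC (Num.truncn (C%:R / c)).+1 Logic.I.
  exists n => // K /= nK; apply/existsNP; exists n.
  apply/not_implyP; split; first by rewrite /= nK andbT (leq_trans _ Nn).
  apply; rewrite /= /b' subr_le0 (le_trans bn)// -ler_pdivrMr//.
  by rewrite (le_trans (ltW (truncnS_gt _)))// ler_nat.
pose p x := Num.max (b' 1%N x) 0.
have intp : integrable p by exact: integrable_max0.
have e0 := Rintegral_patch_cvg0 intp mB BG.
have ce K : c <= \int[mu]_x (p \_ (B K)) x.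
  have hB x : ~ B K x -> exists2 k, (0 < k <= K)%N & b' k x <= 0.
    by move=> /existsNP[k /not_implyP[kK /contrapT bk]]; exists k.
  (* The covering bound is integrated at time [q + K]; invariance of the measure removes the shift
     by q in the last term, which therefore stays bounded as q grows. *)
  have key q : q%:R * c <= q%:R * \int[mu]_x (p \_ (B K)) x + K%:R * \int[mu]_x p x.
    rewrite -(Rintegral_birkhoff L_pres)//; last exact: integrable_patch.
    rewrite -(Rintegral_birkhoff L_pres K intp).
    rewrite -(Rintegral_iter L_pres q (integrable_birkhoff L_pres K intp)).
    rewrite -RintegralD//; last 2 first.
    - by apply: integrable_birkhoff => //; exact: integrable_patch.
    - by apply: integrable_iter => //; exact: integrable_birkhoff.
    apply: (@le_trans _ _ (\int[mu]_x b' (q + K)%N x)).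
      by rewrite (le_trans _ (int_b' _))// ler_wpM2r ?(ltW c0)// ler_nat leq_addr.
    apply: le_Rintegral => //; last by move=> x _; exact: subadditive_cover.
    apply: integrable_addr.
      by apply: integrable_birkhoff => //; exact: integrable_patch.
    by apply: integrable_iter => //; exact: integrable_birkhoff.
  rewrite leNgt; apply/negP => ec.
  set e := (X in X < c) in ec; set P := \int[mu]_x p x in key.
  have ce0 : 0 < c - e by rewrite subr_gt0.
  (* For this q the gain [q * (c - e)] exceeds the boundary term [K * P], against [key]. *)
  have := key (Num.truncn (K%:R * P / (c - e))).+1.
  apply/negP; rewrite -ltNge -ltrBrDl -mulrBr -ltr_pdivrMr//.
  exact: truncnS_gt.
have : c <= 0.
  by apply: cvgr_to_ge e0 _; apply: nearW.
by rewrite leNgt c0.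
Qed.

End subadditive_ergodic.

(** * Kingman's theorem for nonnegative integrable subadditive cocycles *)

Section kingman.
Context {R : realType} {d : measure_display} {M : measurableType d}.
Context (mu : probability M R) (L : M -> M).
Hypothesis L_ergodic : ergodic mu L.
Implicit Types (f g w : M -> R) (n k : nat) (x : M).

Local Notation integrable f := (mu.-integrable setT (EFin \o f)).

Let L_pres : measure_preserving mu L. Proof. by case: L_ergodic. Qed.

(** Birkhoff sums are additive in time, so [n * c] minus such a sum is again a subadditive cocycle;
    its integral is n times the positive gap between c and the mean of w. *)
Lemma eventually_birkhoff_lt w (c : R) :
  integrable w -> \int[mu]_x w x < c ->
  {ae mu, forall x, \forall n \near \oo, birkhoff L w n x < n%:R * c}.
Proof.
move=> intw wc.
have intS n := integrable_birkhoff L_pres n intw.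
have intNS n : integrable (fun x => -1 * birkhoff L w n x).
  exact: integrable_mulrl.
have intb n : integrable (fun x => n%:R * c + -1 * birkhoff L w n x).
  exact: (integrable_addr (integrable_cst_prob _ (n%:R * c))).
have := @eventually_gt0 _ _ _ mu L L_ergodic
  (fun n x => n%:R * c + -1 * birkhoff L w n x) (c - \int[mu]_x w x).
case=> //.
- split=> [x|n k x]; first by rewrite birkhoff0; lra.
  by rewrite birkhoffD natrD; lra.
- by rewrite subr_gt0.
- move=> n; rewrite RintegralD//; last exact: (integrable_cst_prob _ (n%:R * c)).
  rewrite (Rintegral_prob_cst mu (n%:R * c)) RintegralZl//.
  by rewrite (Rintegral_birkhoff L_pres)//; lra.
move=> A [mA A0 sA]; exists A; split => // x /= h; apply: sA => /= h'; apply: h.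
by apply: filterS h' => n; lra.
Qed.

Variable a : nat -> M -> R.
Hypothesis a_subadd : subadditive L a.
Hypothesis a_int : forall n, integrable (a n).
Hypothesis a_ge0 : forall n x, 0 <= a n x.

Lemma eventually_gt_subadditive (gamma c : R) :
  (forall n, n%:R * gamma <= \int[mu]_x a n x) -> c < gamma ->
  {ae mu, forall x, \forall n \near \oo, n%:R * c < a n x}.
Proof.
move=> gammaP cg.
have intc n := integrable_cst_prob mu (- (n%:R * c)).
have := @eventually_gt0 _ _ _ mu L L_ergodic
  (fun n x => a n x - n%:R * c) (gamma - c).
case.
- exact: subadditiveB.
- by move=> n; exact: (integrable_addr (a_int n) (intc n)).
- by rewrite subr_gt0.
- move=> n; rewrite RintegralD//; last exact: (intc n).
  rewrite (Rintegral_prob_cst mu (- (n%:R * c))).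
  by have := gammaP n; lra.
move=> A [mA A0 sA]; exists A; split => // x /= h; apply: sA => /= h'; apply: h.
by apply: filterS h' => n; rewrite subr_gt0.
Qed.

(** Sliding the window by one step trades [a n x] for [a (n + k) x], at a cost of at most [a k] at
    the n-th point of the orbit. *)
Lemma sum_window_le k n x :
  \sum_(j < k) a (n + j)%N x <= \sum_(j < k) a j x + birkhoff L (a k) n x.
Proof.
elim: n => [|n ih].
  by rewrite birkhoff0 addr0; under eq_bigr do rewrite add0n.
rewrite -addn1 birkhoffD birkhoff1 addrA -(lerD2l (a n x)).
have -> : a n x + \sum_(j < k) a (n + 1 + j)%N x =
    \sum_(j < k) a (n + j)%N x + a (n + k)%N x.
  transitivity (\sum_(j < k.+1) a (n + j)%N x); last by rewrite big_ord_recr.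
  rewrite big_ord_recl /= addn0; congr (_ + _); apply: eq_bigr => j _.
  by rewrite /bump leq0n addnA.
by have := proj2 a_subadd n k x; move: ih; lra.
Qed.

(** The last [k - j] steps cost at most a Birkhoff sum of [a 1]. Nonnegativity extends this sum to
    the whole window, so that the bound no longer depends on j and can be summed over the window. *)
Lemma subadditive_tail k n j x : (j < k)%N ->
  a (n + k)%N x <= a (n + j)%N x + birkhoff L (a 1%N) k (iter n L x).
Proof.
move=> jk; have -> : (n + k = n + j + (k - j))%N by lia.
rewrite (le_trans (proj2 a_subadd _ _ _))// lerD2l.
rewrite (le_trans (subadditive_le_birkhoff _ _ a_subadd))//.
rewrite -{2}(subnKC (ltnW jk)) birkhoffD -iterD addnC lerDr.
exact: birkhoff_ge0.
Qed.

(* The window sums telescope: the average of a over a window of length k grows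
   by a_k / k per step, at the price of boundary terms controlled by a_1; the
   values of a_1 above a threshold t are absorbed in a Birkhoff sum. *)
Lemma subadditive_window_bound k n t x :
  k%:R * a (n + k)%N x <= \sum_(j < k) a j x + k%:R * (k%:R * t%:R) +
    birkhoff L (fun y => a k y +
      k%:R * (a 1%N \_ [set y | t%:R < a 1%N y]) y) (n + k) x.
Proof.
set B := [set y | _]; set w := (X in birkhoff _ X).
have u0 y : 0 <= (a 1%N \_ B) y by rewrite patchE; case: ifP.
have : \sum_(j < k) a (n + k)%N x <=
    \sum_(j < k) (a (n + j)%N x + birkhoff L (a 1%N) k (iter n L x)).
  by apply: ler_sum => j _; exact: subadditive_tail.
rewrite big_split /= !sumr_const card_ord -(mulr_natl (a _ _)).
rewrite -(mulr_natl (birkhoff _ _ _ _)).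
have := sum_window_le k n x.
have : birkhoff L (a 1%N) k (iter n L x) <=
    k%:R * t%:R + birkhoff L (a 1%N \_ B) k (iter n L x).
  have -> : k%:R * t%:R = \sum_(i < k) t%:R :> R.
    by rewrite sumr_const card_ord mulr_natl.
  rewrite -big_split /=.
  apply: ler_sum => i _; rewrite patchE; case: ifPn => [_|/negP nB].
    by rewrite lerDr.
  by rewrite addr0 leNgt; apply/negP => h; apply: nB; rewrite inE.
have : birkhoff L (a k) n x <= birkhoff L w n x.
  by apply: ler_birkhoff => y; rewrite lerDl mulr_ge0.
have : k%:R * birkhoff L (a 1%N \_ B) k (iter n L x) <=
    birkhoff L w k (iter n L x).
  by rewrite mulr_sumr; apply: ler_sum => i _; rewrite lerDr.
have k0 : 0 <= k%:R :> R by [].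
rewrite birkhoffD => h1 h2 /(ler_wpM2l k0); rewrite mulrDr; move: h1 h2; lra.
Qed.

Lemma eventually_lt_subadditive k (c : R) :
  \int[mu]_x a k x < k%:R * c -> (0 < k)%N ->
  {ae mu, forall x, \forall n \near \oo, a n x < n%:R * c}.
Proof.
move=> akc k0.
have kR0 : 0 < k%:R :> R by rewrite ltr0n.
pose e := k%:R * c - \int[mu]_x a k x.
have e0 : 0 < e by rewrite subr_gt0.
pose B t := [set y | t%:R < a 1%N y].
have mB t : measurable (B t).
  rewrite (_ : B t = ~` [set y | a 1%N y <= t%:R]).
    apply: measurableC; apply: measurable_le_cst.
    exact: (integrable_measurable (a_int 1)).
  by apply/seteqP; split => y; rewrite /B /= ltNge => /negP.
have Bx x : \forall t \near \oo, ~ B t x.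
  exists (Num.truncn (a 1%N x)).+1 => // t /= xt.
  by apply/negP; rewrite -leNgt (le_trans (ltW (truncnS_gt _)))// ler_nat.
(* The threshold t is so high that k times the integral of the part of [a 1] above it is less than
   [e / 2]; the other half of e pays for the constant C below. *)
have /cvgrPdist_lt/(_ (e / 2 / k%:R)) :=
  Rintegral_patch_cvg0 (a_int 1) mB (aeW mu Bx).
rewrite !divr_gt0// => /(_ isT)[t _ /(_ t (leqnn t))] /=.
rewrite sub0r normrN => /(le_lt_trans (ler_norm _)).
rewrite ltr_pdivlMr// => ut.
have intu : integrable (a 1%N \_ (B t)) by exact: integrable_patch.
have intku := integrable_mulrl k%:R intu.
have intw := integrable_addr (a_int k) intku.
have /(eventually_birkhoff_lt intw) :
    \int[mu]_x (a k x + k%:R * (a 1%N \_ (B t)) x) < k%:R * c - e / 2.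
  by rewrite RintegralD// RintegralZl//; move: ut; rewrite /e; lra.
case=> A [mA A0 sA]; exists A; split => // x /= h; apply: sA => /= h'; apply: h.
set C := \sum_(j < k) a j x + k%:R * (k%:R * t%:R).
near=> n.
have kn : (k <= n)%N by near: n; exact: nbhs_infty_ge.
have := subadditive_window_bound k (n - k) t x; rewrite subnK// -/C -/(B t).
have Cn : C <= n%:R * (e / 2).
  rewrite -ler_pdivrMr ?divr_gt0//; near: n; exact: nbhs_infty_ger.
have : birkhoff L (fun y => a k y + k%:R * (a 1%N \_ (B t)) y) n x <
  n%:R * (k%:R * c - e / 2) by near: n.
move=> h1 h2; rewrite -(ltr_pM2l kR0).
by move: Cn h1 h2; rewrite mulrBr; lra.
Unshelve. all: by end_near.
Qed.

Theorem kingman : exists lambda : R,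
  {ae mu, forall x, a n x / n%:R @[n --> \oo] --> lambda}.
Proof.
(* The index [n.+1] avoids a quotient by 0; nonnegativity of a bounds S from below, so its infimum
   is finite. *)
pose S := range (fun n => (\int[mu]_x a n.+1 x) / n.+1%:R).
have Slb : lbound S 0.
  by move=> _ [n _ <-]; rewrite divr_ge0// Rintegral_ge0.
have infS : has_inf S.
  by split; [exists ((\int[mu]_x a 1%N x) / 1); exists 0%N|exists 0].
pose gamma := inf S.
have gammaP n : n%:R * gamma <= \int[mu]_x a n x.
  case: n => [|n]; first by rewrite mul0r Rintegral_ge0.
  by rewrite mulrC -ler_pdivlMr// ge_inf//; [exists 0|exists n].
exists gamma.
(* The errors run through the inverses of positive integers, so that only countably many null sets
   have to be united. *)
have lo i : {ae mu, forall x, \forall n \near \oo,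
    n%:R * (gamma - i.+1%:R^-1) < a n x}.
  by apply: (eventually_gt_subadditive gammaP); rewrite ltrBlDr ltrDl invr_gt0.
have up i : {ae mu, forall x, \forall n \near \oo,
    a n x < n%:R * (gamma + i.+1%:R^-1)}.
  have [|_ [k _ <-] kg] := @inf_adherent _ S i.+1%:R^-1 _ infS.
    by rewrite invr_gt0.
  apply: (@eventually_lt_subadditive k.+1) => //.
  by rewrite mulrC -ltr_pdivrMr.
have := filterI (ae_foralln lo) (ae_foralln up).
case=> A [mA A0 sA]; exists A; split => // x /= h; apply: sA => /= -[lox upx].
apply: h; apply/cvgrPdist_lt => e e0.
pose i := Num.truncn e^-1.
have ie : i.+1%:R^-1 < e.
  by rewrite invf_plt ?posrE// truncnS_gt.
near=> n.
have n0 : 0 < n%:R :> R by rewrite ltr0n; near: n; exact: nbhs_infty_gt.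
have lon : n%:R * (gamma - i.+1%:R^-1) < a n x by near: n.
have upn : a n x < n%:R * (gamma + i.+1%:R^-1) by near: n.
apply: lt_trans ie; rewrite ltr_distlC.
rewrite ltr_pdivlMr// ltr_pdivrMr// ![_ * n%:R]mulrC.
by rewrite lon upn.
Unshelve. all: by end_near.
Qed.

End kingman.

(** * Jacobian determinants: chain rule and bounds on a compact set *)

Section jacobians.
Context {R : realType} {N : nat}.
Implicit Types (g h : 'rV[R]_N -> 'rV[R]_N) (x y : 'rV[R]_N).
Implicit Types (U Omega : set 'rV[R]_N).

Lemma mul_jacobian g x u : u *m jacobian g x = 'd g x u.
Proof. by rewrite /jacobian mul_rV_lin1. Qed.

Lemma Jmx_comp g h x : differentiable g x -> differentiable h (g x) ->
  Jmx (h \o g) x = Jmx h (g x) *m Jmx g x.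
Proof.
move=> dg dh; rewrite /Jmx -trmx_mul; congr trmx; apply/row_matrixP => i.
rewrite [LHS]rowE [RHS]rowE; set u := delta_mx _ _.
transitivity ('d h (g x) ('d g x u)).
  rewrite (mul_jacobian (h \o g) x u).
  exact: (congr1 (fun k => k u) (diff_comp dg dh)).
by rewrite (mulmxA u (jacobian g x)) (mul_jacobian g x u) (mul_jacobian h (g x)).
Qed.

(** Stated locally because it serves for [h \o g] with an inverse h that is known only on a
    neighbourhood. *)
Lemma Jmx_id_near g x : differentiable g x -> (\forall y \near x, g y = y) ->
  Jmx g x = 1%:M.
Proof.
move=> dg gid; rewrite /Jmx -[RHS]trmx1; congr trmx; apply/row_matrixP => i.
rewrite [LHS]rowE [RHS]rowE mulmx1 mul_jacobian -deriveE//.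
by rewrite (near_eq_derive (g := id))// derive_id.
Qed.

Lemma absJ_ge0 g x : 0 <= absJ g x.
Proof. exact: normr_ge0. Qed.

Lemma absJ_ratio g x y :
  `|\det (Jmx g x *m invmx (Jmx g y))| = absJ g x / absJ g y.
Proof. by rewrite det_mulmx det_inv normrM normfV. Qed.

Lemma absJ_comp g h x : differentiable g x -> differentiable h (g x) ->
  absJ (h \o g) x = absJ h (g x) * absJ g x.
Proof. by move=> dg dh; rewrite /absJ Jmx_comp// det_mulmx normrM. Qed.

Lemma differentiable_idfun x : differentiable (id : 'rV[R]_N -> 'rV[R]_N) x.
Proof. exact: ex_diff. Qed.

Lemma absJ_id x : absJ id x = 1.
Proof.
rewrite /absJ Jmx_id_near ?det1 ?normr1//.
by apply: filterE.
Qed.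

(** By the Leibniz formula the determinant is a polynomial in the entries. *)
Lemma continuous_absJ g x : {for x, continuous (Jmx g)} ->
  {for x, continuous (absJ g)}.
Proof.
move=> Jc; apply: (@continuous_comp _ _ _ (fun y => \det (Jmx g y)) Num.norm);
  last exact: norm_continuous.
rewrite /determinant /continuous_at.
apply: (@cvg_big R _ +%R 0 xpredT (@add_continuous R) _ (nbhs x) _
  (fun (s : 'S_N) y => (-1) ^+ s * \prod_i Jmx g y i (s i))) => s _.
apply: cvgM; first exact: cvg_cst.
apply: (@cvg_big R _ *%R 1 xpredT (@mul_continuous R) _ (nbhs x) _
  (fun i y => Jmx g y i (s i))) => i _.
exact: (continuous_comp Jc (@coord_continuous _ _ _ i (s i) (Jmx g x))).
Qed.

Lemma absJ_bounded Omega U g : compact Omega -> Omega `<=` U -> C1_on U g ->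
  exists2 C, 0 < C & forall x, Omega x -> absJ g x <= C.
Proof.
move=> cOmega OmegaU [_ Jc].
have [->|/set0P Omega0] := eqVneq Omega set0; first by exists 1.
have [|c _ cP] := EVT_max_rV Omega0 cOmega (f := absJ g).
  apply: continuous_in_subspaceT => x /set_mem Ox; apply: continuous_absJ.
  exact/Jc/OmegaU.
(* Adding 1 makes the bound positive even if the maximum is 0. *)
exists (absJ g c + 1); first by rewrite ltr_wpDl ?absJ_ge0.
by move=> x Ox; rewrite (le_trans (cP x _)) ?inE// lerDl.
Qed.

(* The part of being a diffeomorphism of Omega that the distortion sees; it is
   stable under composition without any care for the neighbourhoods. *)
Definition regular Omega g :=
  [/\ g @` Omega = Omega, forall x, Omega x -> differentiable g x &
      exists2 C, 0 < C & forall x, Omega x -> C^-1 <= absJ g x <= C].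

(** The upper bound comes from compactness. The lower one is the upper bound for the inverse h,
    taken at [g x], which lies in Omega: the two determinants there have product 1. *)
Lemma is_diffeo_regular Omega g :
  compact Omega -> is_diffeo Omega g -> regular Omega g.
Proof.
move=> cOmega [gOmega [U [V [OmegaU]]]].
case=> [oU oV C1g [h [C1h gUV hVU gK hK]]].
have OmegaV : Omega `<=` V.
  by rewrite -gOmega => _ [x Ox <-]; exact/gUV/OmegaU.
have [C C0 CP] := absJ_bounded cOmega OmegaU C1g.
have [C' C'0 C'P] := absJ_bounded cOmega OmegaV C1h.
split=> //; first by move=> x Ox; exact: (proj1 C1g _ (OmegaU _ Ox)).
have m0 : 0 < Num.max C C' by rewrite lt_max C0.
exists (Num.max C C') => // x Ox; rewrite [X in _ && X]le_max CP// andbT.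
have Ogx : Omega (g x) by rewrite -gOmega; exists x.
have dg := proj1 C1g _ (OmegaU _ Ox); have dh := proj1 C1h _ (OmegaV _ Ogx).
have hg : absJ h (g x) * absJ g x = 1.
  rewrite -absJ_comp// /absJ Jmx_id_near ?det1 ?normr1//.
    exact: differentiable_comp.
  have : nbhs x U by apply: open_nbhs_nbhs; split => //; exact: OmegaU.
  by apply: filterS => y Uy /=; rewrite gK// inE.
have h1 := C'P _ Ogx; have J0 := absJ_ge0 g x.
rewrite -(ler_pM2l m0) divff ?gt_eqF// -[leLHS]hg.
by apply: ler_wpM2r => //; rewrite le_max h1 orbT.
Qed.

Lemma regular_id Omega : regular Omega id.
Proof.
split; [exact: image_id|by move=> x _; exact: differentiable_idfun|].
by exists 1 => // x _; rewrite absJ_id invr1 lexx.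
Qed.

(** Measurability of the cocycle is assumed for diffeomorphisms rather than regular maps; it will be
    used with the identity. *)
Lemma is_diffeo_id Omega : is_diffeo Omega id.
Proof.
split; first exact: image_id.
have C1id : C1_on [set: 'rV[R]_N] id.
  split=> x _; first exact: differentiable_idfun.
  rewrite (_ : Jmx id = cst 1%:M); first exact: cst_continuous.
  apply/funext => y; apply: Jmx_id_near; first exact: differentiable_idfun.
  by apply: filterE.
exists setT, setT; split => //; split => //; try exact: openT.
by exists id; split.
Qed.

Lemma regular_comp Omega g h :
  regular Omega g -> regular Omega h -> regular Omega (h \o g).
Proof.
move=> [gO dg [C C0 CP]] [hO dh [C' C'0 C'P]].
have gOx x : Omega x -> Omega (g x) by move=> Ox; rewrite -gO; exists x.
split.
- by rewrite -image_comp gO hO.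
- by move=> x Ox; apply: differentiable_comp; [exact: dg|exact/dh/gOx].
exists (C' * C); first exact: mulr_gt0.
move=> x Ox; rewrite absJ_comp; [|exact: dg|exact/dh/gOx].
have /andP[g1 g2] := CP _ Ox; have /andP[h1 h2] := C'P _ (gOx _ Ox).
have C1 : 0 <= C^-1 by rewrite invr_ge0 ltW.
have C'1 : 0 <= C'^-1 by rewrite invr_ge0 ltW.
rewrite invfM; apply/andP; split; first exact: (ler_pM C'1 C1 h1 g1).
exact: (ler_pM (absJ_ge0 _ _) (absJ_ge0 _ _) h2 g2).
Qed.

End jacobians.

(** * The distortion pseudo-metric in logarithmic form, and its behaviour under composition *)

Lemma ln_cross_ratio {R : realType} (a b c d : R) :
  0 < a -> 0 < b -> 0 < c -> 0 < d ->
  ln ((a / b) * (c / d)) = (ln a - ln b) - (ln d - ln c).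
Proof.
move=> a0 b0 c0 d0.
by rewrite lnM ?posrE ?divr_gt0// !ln_div ?posrE// opprB.
Qed.

Lemma ler_norm_cross (R : realType) (a b c d A B : R) :
  `|a| <= A -> `|b| <= B -> `|c| <= A -> `|d| <= B ->
  `|(a - b) - (c - d)| <= (A + B) + (A + B).
Proof. by rewrite !ler_norml; lra. Qed.

(* Locked because unification would otherwise unfold determinants. *)
HB.lock Definition log_absJ (R : realType) (N : nat)
  (g : 'rV[R]_N -> 'rV[R]_N) (x : 'rV[R]_N) : R := ln (absJ g x).

Lemma log_absJE (R : realType) (N : nat) (g : 'rV[R]_N -> 'rV[R]_N) x :
  log_absJ g x = ln (absJ g x).
Proof. by rewrite log_absJ.unlock. Qed.

Section distortions.
Context {R : realType} {N : nat} (Omega : set 'rV[R]_N).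
Hypothesis Omega_neq0 : Omega !=set0.
Implicit Types (g h k : 'rV[R]_N -> 'rV[R]_N) (x y : 'rV[R]_N).

Local Notation regular := (regular Omega).
Local Notation D := (distortion Omega).

Lemma absJ_gt0 g x : regular g -> Omega x -> 0 < absJ g x.
Proof.
move=> [_ _ [C C0 CP]] Ox; have /andP[+ _] := CP _ Ox.
by apply: lt_le_trans; rewrite invr_gt0.
Qed.

Lemma ln_absJ_bounded g : regular g ->
  exists c, forall x, Omega x -> `|log_absJ g x| <= c.
Proof.
move=> rg; have [_ _ [C C0 CP]] := rg; exists (ln C) => x Ox.
have /andP[h1 h2] := CP _ Ox; have J0 := absJ_gt0 rg Ox.
by rewrite log_absJE ler_norml -lnV ?posrE// !ler_ln ?posrE ?invr_gt0 ?h1.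
Qed.

Lemma log_absJ_id x : log_absJ id x = 0.
Proof. by rewrite log_absJE absJ_id ln1. Qed.

(** With the logarithms separated, the expression telescopes in g and h and is antisymmetric in x
    and y, so that the properties of the distortion reduce to linear arithmetic. *)
Definition log_ratio g h x y : R :=
  (log_absJ g x - log_absJ h x) - (log_absJ g y - log_absJ h y).

Lemma log_ratioE g h x y : regular g -> regular h -> Omega x -> Omega y ->
  ln ((absJ g x / absJ h x) * (absJ h y / absJ g y)) = log_ratio g h x y.
Proof.
move=> rg rh Ox Oy; rewrite /log_ratio !log_absJE.
exact: (ln_cross_ratio (absJ_gt0 rg Ox) (absJ_gt0 rh Ox)
  (absJ_gt0 rh Oy) (absJ_gt0 rg Oy)).
Qed.

Lemma distortion_le g h (c : R) : regular g -> regular h ->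
  (forall x y, Omega x -> Omega y -> `|log_ratio g h x y| <= c) -> D g h <= c.
Proof.
move=> rg rh gc; have [x0 Ox0] := Omega_neq0.
apply: ge_sup; first by eexists; exists x0 => //; exists x0.
by move=> _ [x Ox [y Oy <-]]; rewrite log_ratioE// gc.
Qed.

Lemma le_distortion g h x y : regular g -> regular h -> Omega x -> Omega y ->
  `|log_ratio g h x y| <= D g h.
Proof.
move=> rg rh Ox Oy; rewrite -log_ratioE//; apply: ub_le_sup; last first.
  by exists x => //; exists y.
have [c cP] := ln_absJ_bounded rg; have [c' c'P] := ln_absJ_bounded rh.
exists ((c + c') + (c + c')) => _ [u Ou [v Ov <-]]; rewrite log_ratioE//.
exact: (ler_norm_cross (cP _ Ou) (c'P _ Ou) (cP _ Ov) (c'P _ Ov)).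
Qed.

Lemma distortion_ge0 g h : regular g -> regular h -> 0 <= D g h.
Proof.
move=> rg rh; have [x0 Ox0] := Omega_neq0.
exact: (le_trans (normr_ge0 _) (le_distortion rg rh Ox0 Ox0)).
Qed.

Lemma distortion_triangle g h k : regular g -> regular h -> regular k ->
  D g k <= D g h + D h k.
Proof.
move=> rg rh rk; apply: (distortion_le rg rk) => x y Ox Oy.
have -> : log_ratio g k x y = log_ratio g h x y + log_ratio h k x y.
  by rewrite /log_ratio; lra.
exact: (le_trans (ler_normD _ _)
  (lerD (le_distortion rg rh Ox Oy) (le_distortion rh rk Ox Oy))).
Qed.

(** By the chain rule both logarithms gain the same summand [log_absJ k], which cancels; what
    remains is the log-ratio of g and h at two image points, still in Omega. *)
Lemma distortion_comp g h k : regular g -> regular h -> regular k ->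
  D (g \o k) (h \o k) <= D g h.
Proof.
move=> rg rh rk; have rgk := regular_comp rk rg; have rhk := regular_comp rk rh.
have [kO dk _] := rk; have [_ dg _] := rg; have [_ dh _] := rh.
have Ok x : Omega x -> Omega (k x) by move=> Ox; rewrite -kO; exists x.
apply: (distortion_le rgk rhk) => x y Ox Oy.
suff -> : log_ratio (g \o k) (h \o k) x y = log_ratio g h (k x) (k y).
  exact: (le_distortion rg rh (Ok _ Ox) (Ok _ Oy)).
have lnJ l z : regular l -> Omega z ->
    log_absJ (l \o k) z = log_absJ l (k z) + log_absJ k z.
  move=> rl Oz; have [_ dl _] := rl.
  rewrite !log_absJE absJ_comp; [|exact: dk|exact/dl/Ok].
  exact: (lnM (absJ_gt0 rl (Ok _ Oz)) (absJ_gt0 rk Oz)).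
rewrite /log_ratio (lnJ g x rg Ox) (lnJ g y rg Oy) (lnJ h x rh Ox) (lnJ h y rh Oy).
lra.
Qed.

Lemma distortion_comp_id g k : regular g -> regular k ->
  D (g \o k) id <= D g id + D k id.
Proof.
move=> rg rk; have rid := regular_id Omega.
apply: le_trans (distortion_triangle (regular_comp rk rg) rk rid) _.
by rewrite lerD2r; exact: (distortion_comp rg rid rk).
Qed.

(** The triangle inequality through [g \o k]. With the preceding bound it shows that an outer map g
    changes the distortion by a bounded amount, whatever k is. *)
Lemma distortion_comp_id_ge g k : regular g -> regular k ->
  D k id <= D id g + D (g \o k) id.
Proof.
move=> rg rk; have rid := regular_id Omega.
apply: le_trans (distortion_triangle rk (regular_comp rk rg) rid) _.
by rewrite lerD2r; exact: (distortion_comp rid rg rk).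
Qed.

(* Since x and y can be exchanged, the supremum of |log| in the distortion is
   also the supremum of log. *)
Lemma sup_ratio_powR g n : regular g -> (0 < n)%N ->
  sup [set `|\det (Jmx g x *m invmx (Jmx g y))| `^ (n%:R^-1)
       | x in Omega & y in Omega] = expR (D g id / n%:R).
Proof.
move=> rg n0; have nR0 : 0 < n%:R :> R by rewrite ltr0n.
have rid := regular_id Omega; have [x0 Ox0] := Omega_neq0.
have E x y : Omega x -> Omega y ->
    `|\det (Jmx g x *m invmx (Jmx g y))| `^ (n%:R^-1) =
    expR (log_ratio g id x y / n%:R).
  move=> Ox Oy; have Jx := absJ_gt0 rg Ox; have Jy := absJ_gt0 rg Oy.
  rewrite absJ_ratio /powR (gt_eqF (divr_gt0 Jx Jy)) (ln_div Jx Jy) mulrC.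
  by rewrite /log_ratio !log_absJ_id !subr0 !log_absJE.
set S := [set _ | _ in _ & _ in _].
have S0 : S !=set0 by eexists; exists x0 => //; exists x0.
have Sub : ubound S (expR (D g id / n%:R)).
  move=> _ [x Ox [y Oy <-]]; rewrite E// ler_expR ler_pM2r ?invr_gt0//.
  by rewrite (le_trans (ler_norm _))// le_distortion.
apply/eqP; rewrite eq_le ge_sup//=.
have lesup x y : Omega x -> Omega y -> expR (log_ratio g id x y / n%:R) <= sup S.
  move=> Ox Oy; apply: ub_le_sup; first by exists (expR (D g id / n%:R)).
  by exists x => //; exists y => //; rewrite E.
have sup0 : 0 < sup S by rewrite (lt_le_trans (expR_gt0 _) (lesup _ _ Ox0 Ox0)).
(* Positivity of the supremum allows passing to its logarithm, which leaves a bound on [D g id] to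
   be checked pair by pair. *)
rewrite -[leRHS]lnK ?posrE// ler_expR ler_pdivrMr//.
apply: distortion_le => // x y Ox Oy.
have lele u v : Omega u -> Omega v -> log_ratio g id u v <= ln (sup S) * n%:R.
  move=> Ou Ov; rewrite -ler_pdivrMr// -ler_expR lnK ?posrE//.
  exact: lesup.
rewrite ler_norml lele// andbT lerNl.
by rewrite (_ : - _ = log_ratio g id y x) ?lele// /log_ratio; lra.
Qed.

Context {M : Type} (L : M -> M) (T : M -> 'rV[R]_N -> 'rV[R]_N).
Hypothesis T_regular : forall m, regular (T m).

Lemma layersD m n q :
  layers L T m (n + q) = layers L T (iter n L m) q \o layers L T m n.
Proof.
elim: q => [|q ih]; first by rewrite addn0.
by rewrite addnS /= ih -iterD addnC.
Qed.

Lemma layers_regular m n : regular (layers L T m n).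
Proof.
elim: n => [|n ih]; first exact: regular_id.
exact: regular_comp ih (T_regular _).
Qed.

Lemma subadditive_layers :
  subadditive L (fun n m => D (layers L T m n) id).
Proof.
have rid := regular_id Omega.
split=> [m|n q m].
  apply/eqP; rewrite eq_le distortion_ge0// andbT /=; apply: distortion_le => //.
  by move=> x y _ _; rewrite /log_ratio /= !log_absJ_id !subrr normr0.
rewrite layersD addrC; apply: distortion_comp_id; exact: layers_regular.
Qed.

End distortions.

(** * Integrability and growth of the distortion of the layers *)

Section distortion_cocycle.
Context {R : realType} {N : nat} (Omega : set 'rV[R]_N).
Hypotheses (Omega_compact : compact Omega) (Omega_neq0 : Omega !=set0).
Context {d : measure_display} {M : measurableType d} (mu : probability M R).
Context (L : M -> M) (T : M -> 'rV[R]_N -> 'rV[R]_N).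
Hypothesis T_stationary : stationary_diffeos Omega mu L T.

Local Notation D := (distortion Omega).
Local Notation a n m := (distortion Omega (layers L T m n) id).

Let rid := regular_id Omega.

Lemma layer_regular m : regular Omega (T m).
Proof. exact: is_diffeo_regular (cocycle_diffeo T_stationary m). Qed.

Let r_layers := layers_regular L layer_regular.

Lemma distortion_layers_ge0 n m : 0 <= a n m.
Proof. exact: distortion_ge0 (r_layers m n) rid. Qed.

Lemma measurable_distortion_layers n : measurable_fun setT (fun m => a n m).
Proof.
exact: (cocycle_measurable T_stationary n (is_diffeo_id Omega) (is_diffeo_id Omega)).
Qed.

(** Integrability is assumed for the distance between [g \o T m] and g. Two triangle inequalities
    bound [a 1 m] by this distance plus a constant, and constants are integrable for a
    probability. *)
Lemma integrable_distortion_layer :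
  mu.-integrable setT (EFin \o (fun m => a 1%N m)).
Proof.
have [g dg intg] := cocycle_integrable T_stationary.
have rg : regular Omega g by exact: is_diffeo_regular.
have Dg_ge0 m : 0 <= D (g \o T m) g.
  exact: (distortion_ge0 Omega_neq0 (regular_comp (layer_regular m) rg) rg).
have int1 : mu.-integrable setT (EFin \o (fun m => D (g \o T m) g)).
  apply/integrableP; split.
    apply/measurable_EFinP.
    exact: (cocycle_measurable T_stationary 1 dg dg).
  move: intg; congr (_ < _)%E; apply: eq_integral => m _ /=.
  by rewrite ger0_norm.
pose c := D id g + D g id.
have int2 := integrable_addr int1 (integrable_cst_prob mu c).
apply: (le_integrable measurableT _ _ int2).
  by apply/measurable_EFinP; exact: measurable_distortion_layers.
move=> m _ /=; rewrite lee_fin (ger0_norm (distortion_layers_ge0 1 m)).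
apply: (le_trans _ (ler_norm _)).
have rT := layer_regular m.
have h1 : a 1%N m <= D id g + D (g \o T m) id.
  exact: (distortion_comp_id_ge Omega_neq0 rg rT).
have h2 := distortion_triangle Omega_neq0 (regular_comp rT rg) rg rid.
by rewrite /= /c addrCA; exact: (le_trans h1 (lerD (lexx _) h2)).
Qed.

Lemma integrable_distortion_layers n :
  mu.-integrable setT (EFin \o (fun m => a n m)).
Proof.
have L_pres := proj1 (cocycle_ergodic T_stationary).
have suba := subadditive_layers Omega_neq0 L layer_regular.
apply: (le_integrable measurableT _ _
  (integrable_birkhoff L_pres n integrable_distortion_layer)).
  by apply/measurable_EFinP; exact: measurable_distortion_layers.
move=> m _ /=; rewrite lee_fin (ger0_norm (distortion_layers_ge0 n m)).
apply: le_trans (ler_norm _).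
exact: (subadditive_le_birkhoff n m suba).
Qed.

Lemma distortion_layers_growth : exists lambda : R,
  {ae mu, forall m, a n m / n%:R @[n --> \oo] --> lambda}.
Proof.
apply: (@kingman _ _ _ mu L (cocycle_ergodic T_stationary) (fun n m => a n m)).
- exact: subadditive_layers layer_regular.
- exact: integrable_distortion_layers.
- exact: distortion_layers_ge0.
Qed.

End distortion_cocycle.

(** * From the growth of the layers to that of the functions f_n *)

Lemma cvg_div_natr_shift (R : realType) (u v : nat -> R) (c l : R) :
  (forall n, `|u n - v n| <= c) ->
  u n / n%:R @[n --> \oo] --> l -> v n / n%:R @[n --> \oo] --> l.
Proof.
move=> uv ul.
have cn : c / n%:R @[n --> \oo] --> (0 : R).
  rewrite -(mulr0 c); apply: cvgM; first exact: cvg_cst.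
  apply/gtr0_cvgV0; last exact: cvgr_idn.
  by near=> n; rewrite ltr0n; near: n; exact: nbhs_infty_gt.
have lo : u n / n%:R - c / n%:R @[n --> \oo] --> l.
  by rewrite -[X in _ --> X]subr0; exact: cvgB.
have up : u n / n%:R + c / n%:R @[n --> \oo] --> l.
  by rewrite -[X in _ --> X]addr0; exact: cvgD.
have uvn : \forall n \near \oo,
    u n / n%:R - c / n%:R <= v n / n%:R <= u n / n%:R + c / n%:R.
  near=> n; have n0 : 0 <= n%:R^-1 :> R by rewrite invr_ge0.
  rewrite -mulrBl -mulrDl; have := uv n; rewrite ler_norml => /andP[h1 h2].
  by rewrite !ler_wpM2r//; move: h1 h2; lra.
exact: squeeze_cvgr uvn _ lo up.
Unshelve. all: by end_near.
Qed.

Lemma ler_normB_of_le (R : realDomainType) (a b r s : R) :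
  0 <= r -> 0 <= s -> b <= s + a -> a <= r + b -> `|a - b| <= r + s.
Proof. by rewrite ler_norml; lra. Qed.

Unset Implicit Arguments.

Theorem theorem7 (R : realType) (N : nat) (Omega : set 'rV[R]_N)
    (Omega_compact : compact Omega) (Omega_neq0 : Omega !=set0)
    (f : 'rV[R]_N -> 'rV[R]_N) (f_diffeo : is_diffeo Omega f)
    (d : measure_display) (M : measurableType d) (mu : probability M R)
    (L : M -> M) (T : M -> 'rV[R]_N -> 'rV[R]_N)
    (T_stationary : stationary_diffeos Omega mu L T) :
  exists lambda : R,
    {ae mu, forall m : M,
      (fun n : nat =>
        let f_n := f \o layers L T m n in
        sup [set `|\det (Jmx f_n x *m invmx (Jmx f_n y))| `^ (n%:R^-1)
             | x in Omega & y in Omega])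
      @ \oo --> expR lambda}.
Proof.
have rf : regular Omega f by exact: is_diffeo_regular.
have rid := regular_id Omega.
have rT m : regular Omega (T m) by exact: (layer_regular Omega_compact T_stationary).
have rlayers := layers_regular L rT.
have [lambda ae_lambda] :=
  distortion_layers_growth Omega_compact Omega_neq0 T_stationary.
exists lambda; apply: filterS ae_lambda => m a_lambda.
(* One summand for each direction of the comparison between the layers with and without f. *)
pose c := distortion Omega id f + distortion Omega f id.
have /cvg_div_natr_shift/(_ a_lambda) : forall n,
    `|distortion Omega (layers L T m n) id -
      distortion Omega (f \o layers L T m n) id| <= c.
  move=> n; have h1 := distortion_comp_id Omega_neq0 rf (rlayers m n).
  have h2 := distortion_comp_id_ge Omega_neq0 rf (rlayers m n).
  exact: (ler_normB_of_le (distortion_ge0 Omega_neq0 rid rf)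
    (distortion_ge0 Omega_neq0 rf rid) h1 h2).
move=> /(continuous_cvg _ (@continuous_expR R lambda)).
(* The supremum is the exponential of the normalized distortion for positive n, hence the passage
   through eventual equality. *)
apply: cvg_trans; apply: near_eq_cvg; near=> n.
have n0 : (0 < n)%N by near: n; exact: nbhs_infty_gt.
have E := sup_ratio_powR Omega_neq0 (regular_comp (rlayers m n) rf) n0.
exact: (esym E).
Unshelve. all: by end_near.
Qed.
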